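(* Let $A=A^\top\in\mathbb{R}^{n\times n}$ be such that the undirected graph $\mathcal{G}(A)$ is a tree, and let $B=\mathbf{e}_1\in\mathbb{R}^n$ (so that node $1$ is the single leader). Suppose that all the other nodes (followers) have distance at most $2$ from node $1$, the $m_1$ nodes at distance $1$ being $\mathcal{F}_1=\{2,\dots,m_1+1\}$ and the $m_2$ nodes at distance $2$ being $\mathcal{F}_2=\{m_1+2,\dots,n\}$, $n=1+m_1+m_2$, so that $$A=\begin{bmatrix}0&A_{12}&\mathbf{0}_{1\times m_2}\\ A_{21}&\mathbf{0}_{m_1\times m_1}&A_{23}\\ \mathbf{0}_{m_2\times 1}&A_{32}&\mathbf{0}_{m_2\times m_2}\end{bmatrix},$$ where $A_{21}=A_{12}^\top\in\mathbb{R}^{m_1}$ and $A_{32}=A_{23}^\top\in\mathbb{R}^{m_2\times m_1}$. Then the pair $(A,B)$ is herdable if and only if for every $i,j\in\{1,\dots,m_1\}$ (including $i=j$) such that $$[A_{23}A_{32}]_{ii}=[A_{23}A_{32}]_{jj},$$ we have: (i) $[A_{21}]_i\cdot[A_{21}]_j>0$; (ii) $A_{32}(\mathbf{e}_i+\mathbf{e}_j)$ is either zero or unisigned.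
   Context: Graph of a matrix: for a symmetric $A\in\mathbb{R}^{n\times n}$, $\mathcal{G}(A)$ is the signed weighted undirected graph with node set $\{1,\dots,n\}$ and an edge between $j$ and $i$ if and only if $[A]_{ij}=[A]_{ji}\neq 0$, with weight $[A]_{ij}$. It is a tree if it is connected and acyclic (in particular without self-loops, so $A$ has zero diagonal). The distance between two nodes is the minimum number of edges of a walk joining them. $\mathbf{e}_i$ is the $i$-th canonical basis vector (of $\mathbb{R}^n$ for $B$, of $\mathbb{R}^{m_1}$ in (ii)). Unisigned: a nonzero vector is unisigned if all its nonzero entries have the same sign. Herdability: a pair $(A,B)$, $A\in\mathbb{R}^{n\times n}$, $B\in\mathbb{R}^{n\times m}$, describing the linear time-invariant (continuous-time or discrete-time) system $\dot{\mathbf x}=A\mathbf{x}+B\mathbf{u}$ or $\mathbf{x}(t+1)=A\mathbf{x}(t)+B\mathbf{u}(t)$, is herdable if for every $\mathbf{x}(0)$ and every $h>0$ there exist $t_f>0$ and an input $\mathbf{u}(t)$, $t\in[0,t_f)$, driving the state from $\mathbf{x}(0)$ to $\mathbf{x}(t_f)\ge h\mathbf{1}_n$ (entrywise). It is known that this is equivalent to the image of the controllability matrix $\mathcal{R}(A,B)=[B\ \ AB\ \ \cdots\ \ A^{n-1}B]$ containing a vector with all entries strictly positive. *)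

(* Defs.v *)
From HB Require Import structures.
From mathcomp Require Import all_boot all_order all_algebra.
From mathcomp Require Import all_classical all_reals all_analysis.
Set Implicit Arguments.
Unset Strict Implicit.
Unset Printing Implicit Defensive.
Import Order.TTheory GRing.Theory Num.Theory.
Import numFieldNormedType.Exports.
Local Open Scope classical_set_scope.
Local Open Scope ring_scope.

(** * Graphs *)

Definition graph_of (R : realType) (n : nat) (A : 'M[R]_n) : rel 'I_n :=
  fun j i => A i j != 0.

(* For a symmetric relation. A walk back and forth along one edge is a [ucycle]
   of size 2, hence the lower bound on the size of a genuine cycle. *)
Definition is_tree (T : finType) (e : rel T) : Prop :=
  [/\ forall x y : T, connect e x y,
      forall x : T, ~~ e x x
    & forall c : seq T, (2 < size c)%N -> ~ ucycle e c].

Definition is_walk (T : eqType) (e : rel T) (x y : T) (p : seq T) : Prop :=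
  path e x p /\ last x p = y.

Definition at_distance (T : eqType) (e : rel T) (x y : T) (d : nat) : Prop :=
  (exists2 p : seq T, is_walk e x y p & size p = d) /\
  (forall p : seq T, is_walk e x y p -> (d <= size p)%N).

(** * Herdability *)

Definition unisigned (R : realType) (n : nat) (v : 'cV[R]_n) : Prop :=
  v != 0 /\
  forall i j : 'I_n, v i 0 != 0 -> v j 0 != 0 ->
    Num.sg (v i 0) = Num.sg (v j 0).

(* Caratheodory solutions of x' = A x + B u for Lebesgue integrable inputs; the
   values of [u] outside [0, tf[ play no role. *)
Definition ct_trajectory (R : realType) (n m : nat)
    (A : 'M[R]_n) (B : 'M[R]_(n, m)) (tf : R)
    (u : R -> 'cV[R]_m) (x : R -> 'cV[R]_n) : Prop :=
  [/\ forall k : 'I_m,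
        (@lebesgue_measure R).-integrable `[0, tf[ (fun s => (u s k 0)%:E),
      forall i : 'I_n, {within `[0, tf], continuous (fun s => x s i 0)}
    & forall t : R, 0 <= t <= tf -> forall i : 'I_n,
        x t i 0 = x 0 i 0 +
          Rintegral (@lebesgue_measure R) `[0, t[
            (fun s => (A *m x s + B *m u s) i 0)].

Definition dt_trajectory (R : realType) (n m : nat)
    (A : 'M[R]_n) (B : 'M[R]_(n, m)) (tf : nat)
    (u : nat -> 'cV[R]_m) (x : nat -> 'cV[R]_n) : Prop :=
  forall t : nat, (t < tf)%N -> x t.+1 = A *m x t + B *m u t.

Definition ct_herdable (R : realType) (n m : nat)
    (A : 'M[R]_n) (B : 'M[R]_(n, m)) : Prop :=
  forall (x0 : 'cV[R]_n) (h : R), 0 < h ->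
  exists (tf : R) (u : R -> 'cV[R]_m) (x : R -> 'cV[R]_n),
    [/\ 0 < tf, x 0 = x0, ct_trajectory A B tf u x
      & forall i : 'I_n, h <= x tf i 0].

Definition dt_herdable (R : realType) (n m : nat)
    (A : 'M[R]_n) (B : 'M[R]_(n, m)) : Prop :=
  forall (x0 : 'cV[R]_n) (h : R), 0 < h ->
  exists (tf : nat) (u : nat -> 'cV[R]_m) (x : nat -> 'cV[R]_n),
    [/\ (0 < tf)%N, x 0%N = x0, dt_trajectory A B tf u x
      & forall i : 'I_n, h <= x tf i 0].

Variant time_domain := ContinuousTime | DiscreteTime.

Definition herdable (T : time_domain) (R : realType) (n m : nat)
    (A : 'M[R]_n) (B : 'M[R]_(n, m)) : Prop :=
  match T with
  | ContinuousTime => ct_herdable A B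
  | DiscreteTime => dt_herdable A B
  end.

(** * One leader, followers in two layers of sizes [m1] and [m2] *)

Definition leader (m1 m2 : nat) : 'I_(1 + (m1 + m2)) := lshift (m1 + m2) ord0.

Definition follower1 (m1 m2 : nat) (i : 'I_m1) : 'I_(1 + (m1 + m2)) :=
  rshift 1 (lshift m2 i).

Definition follower2 (m1 m2 : nat) (k : 'I_m2) : 'I_(1 + (m1 + m2)) :=
  rshift 1 (rshift m1 k).

Definition canonical_vec (R : realType) (n : nat) (i : 'I_n) : 'cV[R]_n :=
  delta_mx i 0.

Definition block21 (R : realType) (m1 m2 : nat)
    (A : 'M[R]_(1 + (m1 + m2))) : 'cV[R]_m1 :=
  usubmx (dlsubmx A).

Definition block23 (R : realType) (m1 m2 : nat)
    (A : 'M[R]_(1 + (m1 + m2))) : 'M[R]_(m1, m2) :=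
  ursubmx (drsubmx A).

Definition block32 (R : realType) (m1 m2 : nat)
    (A : 'M[R]_(1 + (m1 + m2))) : 'M[R]_(m2, m1) :=
  dlsubmx (drsubmx A).

(* Main.v *)
Require Import Defs.
From HB Require Import structures.
From mathcomp Require Import all_boot all_order all_algebra.
From mathcomp Require Import all_classical all_reals all_analysis.
From mathcomp Require Import ring lra.
Set Implicit Arguments.
Unset Strict Implicit.
Unset Printing Implicit Defensive.
Import Order.TTheory GRing.Theory Num.Theory.
Import numFieldNormedType.Exports.
Local Open Scope ring_scope.

(* Let [d i] be the sum of the squared weights of the edges below the first
   layer node [i]; this is the diagonal entry (i, i) of [A23 A32]. Write
   [a i] for the weight of its edge to the leader and [b k] for the weight of
   the edge above the second layer node [k].

   Necessity: if [d i = d j], the covectors [p = a j e_i - a i e_j] and [p A]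
   span an A-invariant space ([p A A = d i p]) annihilated by B, hence vanish
   on all states reachable from 0, and so do the covectors
   [b k' a j e_k - b k a i e_k'] for [k] below [i] and [k'] below [j]. On a
   positive state this forces [a i a j > 0] and [b k b k' > 0].

   Sufficiency: let D be the time derivative or the time shift, P the product
   of the [X - e] over the distinct values [e] of [d], and
   [L i = P / (X - d i)]. For every function [th],
     x_leader = P(D^2) th,  x_i = a i D L_i(D^2) th,  x_k = b k a i L_i(D^2) th
   is a trajectory for a suitable input. Since the jet of [th] can be prescribed
   at the initial and at the final time, one gets a trajectory from 0 to a
   positive state; a large multiple of it is added to some trajectory starting
   at the given initial state. *)

(* [a] collects the weights of the edges at the leader, [b k] is the weight of
   the edge joining the outer node [k] to its parent [par k]. The row of the
   leader is left out, as the input can overwrite it. *)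
Record two_layer_tree (R : realType) (m1 m2 : nat)
    (A : 'M[R]_(1 + (m1 + m2))) (a : 'I_m1 -> R) (b : 'I_m2 -> R)
    (par : 'I_m2 -> 'I_m1) : Prop := {
  weight1_neq0 : forall i, a i != 0;
  weight2_neq0 : forall k, b k != 0;
  entry1L : forall i, A (follower1 m2 i) (leader m1 m2) = a i;
  entry2L : forall k, A (follower2 m1 k) (leader m1 m2) = 0;
  entry11 : forall i j, A (follower1 m2 i) (follower1 m2 j) = 0;
  entry12 : forall i k, A (follower1 m2 i) (follower2 m1 k)
                        = b k *+ (par k == i);
  entry21 : forall i k, A (follower2 m1 k) (follower1 m2 i)
                        = b k *+ (par k == i);
  entry22 : forall k l, A (follower2 m1 k) (follower2 m1 l) = 0 }.

(** * Nodes sorted by layer *)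

Section Nodes.
Context {m1 m2 : nat}.

Variant node_spec : 'I_(1 + (m1 + m2)) -> Type :=
| NodeL : node_spec (leader m1 m2)
| Node1 i : node_spec (follower1 m2 i)
| Node2 k : node_spec (follower2 m1 k).

Lemma nodeP v : node_spec v.
Proof.
case: (splitP v) => [j vj|j vj].
  suff -> : v = leader m1 m2 by exact: NodeL.
  by apply/val_inj; rewrite /= vj ord1.
have [k jk|k jk] := splitP j.
  have -> : v = follower1 m2 k by apply/val_inj; rewrite /= vj jk.
  exact: Node1.
have -> : v = follower2 m1 k by apply/val_inj; rewrite /= vj jk.
exact: Node2.
Qed.

Lemma leader_neq1 i : (leader m1 m2 == follower1 m2 i) = false.
Proof. by []. Qed.

Lemma leader_neq2 k : (leader m1 m2 == follower2 m1 k) = false.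
Proof. by []. Qed.

Lemma follower1_inj : injective (@follower1 m1 m2).
Proof. by move=> i j /(@rshift_inj _ _) /(@lshift_inj _ _). Qed.

Lemma follower2_inj : injective (@follower2 m1 m2).
Proof. by move=> i j /(@rshift_inj _ _) /(@rshift_inj _ _). Qed.

Lemma follower1_neq2 i k : (follower1 m2 i == follower2 m1 k) = false.
Proof.
by rewrite /follower1 /follower2 (inj_eq (@rshift_inj _ _)) eq_lrshift.
Qed.

End Nodes.

(** * Structure of the tree *)

Section TreeStructure.
Context (R : realType) (m1 m2 : nat) (A : 'M[R]_(1 + (m1 + m2))).
Hypothesis A_sym : A = A^T.
Hypothesis A_tree : is_tree (graph_of A).
Hypothesis layer1 : forall i : 'I_m1,
  at_distance (graph_of A) (leader m1 m2) (follower1 m2 i) 1.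
Hypothesis layer2 : forall k : 'I_m2,
  at_distance (graph_of A) (leader m1 m2) (follower2 m1 k) 2.

Local Notation l := (leader m1 m2).
Local Notation f1 := (@follower1 m1 m2).
Local Notation f2 := (@follower2 m1 m2).
Local Notation e := (graph_of A).

Lemma graph_sym u v : e u v = e v u.
Proof. by rewrite /graph_of {1}A_sym mxE. Qed.

Lemma graph_irrefl u : e u u = false.
Proof. by case: A_tree => _ + _ => /(_ u) /negbTE. Qed.

Lemma no_cycle c : (2 < size c)%N -> uniq c -> ~~ cycle e c.
Proof.
by case: A_tree => _ _ H c2 uc; apply/negP => cc; apply: (H c c2); apply/andP.
Qed.

Lemma edge_leader1 i : e l (f1 i).
Proof.
case: (layer1 i) => -[p [+ +] sp] _.
by case: p sp => [|v [|w p]] //= _ /andP[lv _] <-.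
Qed.

Lemma no_edge_leader2 k : e l (f2 k) = false.
Proof.
apply/negbTE/negP => lk; case: (layer2 k) => _ /(_ [:: f2 k]) H.
by suff : (2 <= 1)%N by []; apply: H; split=> //=; rewrite lk.
Qed.

(** Two adjacent first-layer nodes would close a triangle with the leader. *)
Lemma no_edge11 i j : e (f1 i) (f1 j) = false.
Proof.
have [->|ij] := eqVneq i j; first exact: graph_irrefl.
apply/negbTE/negP => eij; have := @no_cycle [:: l; f1 i; f1 j] isT.
rewrite !cons_uniq !inE !leader_neq1 (inj_eq follower1_inj) ij => /(_ isT).
by rewrite /= edge_leader1 eij graph_sym edge_leader1.
Qed.

(** The middle node of a walk of length 2 from the leader is adjacent to the leader, hence neither
    the leader itself nor a second-layer node. *)
Lemma ex_parent k : exists i, e (f1 i) (f2 k).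
Proof.
case: (layer2 k) => -[p [+ +] sp] _.
case: p sp => [|v [|w [|? ?]]] //= _ /and3P[lv vw _] wk; move: vw; rewrite wk.
case: (nodeP v) lv => [|i|k'] => [|_ ?|]; first by rewrite graph_irrefl.
  by exists i.
by rewrite no_edge_leader2.
Qed.

(** Two distinct parents would close a 4-cycle through the leader. *)
Lemma parent_unique k i j : e (f1 i) (f2 k) -> e (f1 j) (f2 k) -> i = j.
Proof.
move=> ik jk; apply/eqP/negPn/negP => ij.
have := @no_cycle [:: l; f1 i; f2 k; f1 j] isT.
rewrite !cons_uniq !inE !leader_neq1 leader_neq2 follower1_neq2.
rewrite (inj_eq follower1_inj).
rewrite (negbTE ij) eq_sym follower1_neq2 => /(_ isT).
by rewrite /= edge_leader1 ik graph_sym jk graph_sym edge_leader1.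
Qed.

(** Such an edge closes a triangle with a common parent, or else a 5-cycle through both parents and
    the leader. *)
Lemma no_edge22 k k' : e (f2 k) (f2 k') = false.
Proof.
have [->|kk'] := eqVneq k k'; first exact: graph_irrefl.
apply/negbTE/negP => ekk'; case: (ex_parent k) (ex_parent k') => i ik [j jk'].
have [ij|ij] := eqVneq i j.
  have := @no_cycle [:: f1 i; f2 k; f2 k'] isT.
  rewrite !cons_uniq !inE !follower1_neq2 (inj_eq follower2_inj) kk'.
  move=> /(_ isT).
  by rewrite /= ik ekk' graph_sym ij jk'.
have := @no_cycle [:: l; f1 i; f2 k; f2 k'; f1 j] isT.
rewrite !cons_uniq !inE !leader_neq1 !leader_neq2 !follower1_neq2.
rewrite (inj_eq follower1_inj) (negbTE ij) (inj_eq follower2_inj) (negbTE kk').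
rewrite ![_ == f1 j]eq_sym !follower1_neq2 => /(_ isT).
by rewrite /= edge_leader1 ik ekk' graph_sym jk' graph_sym edge_leader1.
Qed.

Lemma two_layer_treeP : exists a b par, two_layer_tree A a b par.
Proof.
have /fin_all_exists[par parP] := ex_parent.
have ne u v : e u v = false -> A v u = 0 by move=> /negbT/negPn/eqP.
have sA u v : A u v = A v u by rewrite [in LHS]A_sym mxE.
exists (fun i => A (f1 i) l), (fun k => A (f2 k) (f1 (par k))), par.
have e21 i k : A (f2 k) (f1 i) = A (f2 k) (f1 (par k)) *+ (par k == i).
  have [<-//|pki] := eqVneq (par k) i.
  rewrite mulr0n; apply: ne; apply/negbTE/negP => ik.
  by move: pki; rewrite (parent_unique (parP k) ik) eqxx.
split=> //.
- by move=> i; exact: edge_leader1.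
- by move=> k; exact: ne (no_edge_leader2 _).
- by move=> i j; exact: ne (no_edge11 _ _).
- by move=> i k; rewrite sA e21.
- by move=> i k; exact: ne (no_edge22 _ _).
Qed.

End TreeStructure.

(** * Edge weights and the sign conditions *)

Section TwoLayers.
Context {R : realType} {m1 m2 : nat}.
Variables (a : 'I_m1 -> R) (b : 'I_m2 -> R) (par : 'I_m2 -> 'I_m1).

Local Notation l := (leader m1 m2).
Local Notation f1 := (@follower1 m1 m2).
Local Notation f2 := (@follower2 m1 m2).

Definition star_weight (i : 'I_m1) : R := \sum_(k | par k == i) b k ^+ 2.

(** Conditions (i) and (ii) on edge weights: (ii) becomes a common sign for all edges below
    first-layer nodes of equal [star_weight]. *)
Definition aligned : Prop :=
  (forall i j, star_weight i = star_weight j -> 0 < a i * a j) /\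
  (forall k k', star_weight (par k) = star_weight (par k') -> 0 < b k * b k').

Lemma star_weight_ge0 i : 0 <= star_weight i.
Proof. by apply: sumr_ge0 => k _; exact: sqr_ge0. Qed.

Lemma sum_nodes (V : nmodType) (F : 'I_(1 + (m1 + m2)) -> V) :
  \sum_v F v = F l + (\sum_i F (f1 i) + \sum_k F (f2 k)).
Proof. by rewrite big_split_ord big_ord1 big_split_ord. Qed.

Variable A : 'M[R]_(1 + (m1 + m2)).
Hypothesis treeA : two_layer_tree A a b par.

Lemma mulmx_follower1 (x : 'cV[R]_(1 + (m1 + m2))) i :
  (A *m x) (f1 i) 0 = a i * x l 0 + \sum_(k | par k == i) b k * x (f2 k) 0.
Proof.
rewrite mxE sum_nodes (entry1L treeA); congr (_ + _).
rewrite big1 ?add0r => [|j _]; last by rewrite (entry11 treeA) mul0r.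
rewrite [RHS]big_mkcond; apply: eq_bigr => k _; rewrite (entry12 treeA) mulrb.
by case: ifP => // _; rewrite mul0r.
Qed.

Lemma mulmx_follower2 (x : 'cV[R]_(1 + (m1 + m2))) k :
  (A *m x) (f2 k) 0 = b k * x (f1 (par k)) 0.
Proof.
rewrite mxE sum_nodes (entry2L treeA) mul0r add0r.
rewrite [X in _ + X]big1 ?addr0 => [|k' _]; last first.
  by rewrite (entry22 treeA) mul0r.
rewrite (bigD1 (par k))//= (entry21 treeA) eqxx big1 ?addr0// => i /negbTE.
by rewrite eq_sym (entry21 treeA) => ->; rewrite mul0r.
Qed.

Lemma block21E i : block21 A i 0 = a i.
Proof.
rewrite /block21 !mxE -(entry1L treeA); congr (A _ _); exact/val_inj.
Qed.

Lemma block32E k i : block32 A k i = b k *+ (par k == i).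
Proof. by rewrite /block32 !mxE; exact: (entry21 treeA). Qed.

Lemma block23E i k : block23 A i k = b k *+ (par k == i).
Proof. by rewrite /block23 !mxE; exact: (entry12 treeA). Qed.

Lemma block23_mul_block32 i : (block23 A *m block32 A) i i = star_weight i.
Proof.
rewrite mxE /star_weight [RHS]big_mkcond; apply: eq_bigr => k _.
by rewrite block23E block32E mulrb; case: ifP => // _; rewrite mul0r.
Qed.

Lemma block32_canonical_pair i j k :
  (block32 A *m (canonical_vec R i + canonical_vec R j)) k 0 =
  b k *+ (par k == i) + b k *+ (par k == j).
Proof. by rewrite mulmxDr -!colE !mxE -!block32E /block32 !mxE. Qed.

(** Positivity of products treats both alternatives at once, the zero vector satisfying it
    vacuously. *)
Lemma zero_or_unisigned (n : nat) (v : 'cV[R]_n) :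
  (v = 0 \/ unisigned v) <->
  (forall k k', v k 0 != 0 -> v k' 0 != 0 -> 0 < v k 0 * v k' 0).
Proof.
split=> [[->|[_ sv]] k k'|sv]; first by rewrite mxE eqxx.
  move=> vk vk'; rewrite -sgr_gt0 sgrM (sv k k')// -expr2 sqr_sg vk'.
  exact: ltr01.
have [->|v0] := eqVneq v 0; [by left|right; split=> // k k' vk vk'].
have := sv _ _ vk vk'; rewrite -sgr_gt0 sgrM.
by case: (sgrP (v k 0)) vk => //; case: (sgrP (v k' 0)) vk' => // *; lra.
Qed.

(** Entry [k] of the vector in (ii) is [b k] times the number of indices among [i], [j] equal to
    [par k], so its nonzero entries carry the signs of the edges below [i] or [j]. *)
Lemma aligned_blocks :
  (forall i j : 'I_m1,
     (block23 A *m block32 A) i i = (block23 A *m block32 A) j j ->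
     0 < block21 A i 0 * block21 A j 0 /\
     (block32 A *m (canonical_vec R i + canonical_vec R j) = 0 \/
      unisigned (block32 A *m (canonical_vec R i + canonical_vec R j)))) <->
  aligned.
Proof.
split=> [H|[Ha Hb] i j]; last first.
  rewrite !block23_mul_block32 !block21E => dij; split; first exact: Ha.
  apply/zero_or_unisigned => k k'; rewrite !block32_canonical_pair.
  have sE q : b q *+ (par q == i) + b q *+ (par q == j) =
      b q * ((par q == i) + (par q == j))%:R.
    by rewrite -mulrnDr mulr_natr.
  have pos q : b q * ((par q == i) + (par q == j))%:R != 0 ->
      star_weight (par q) = star_weight i /\
      0 < ((par q == i) + (par q == j))%:R :> R.
    case: (eqVneq (par q) i) => [->|_]; first by rewrite ltr0n.
    case: (eqVneq (par q) j) => [->|_]; first by rewrite ltr0n.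
    by rewrite mulr0 eqxx.
  rewrite !sE => /pos[dk ck] /pos[dk' ck'].
  rewrite mulrACA pmulr_lgt0 ?Hb// ?dk ?dk'//.
  exact: mulr_gt0.
split=> [i j dij|k k' dkk'].
  by have [] := H i j; rewrite ?block23_mul_block32// !block21E.
(* Condition (ii) at the two parents compares [b k] and [b k']; a common parent doubles both entries
   and keeps the sign of their product. *)
have [|_ /zero_or_unisigned/(_ k k')] := H (par k) (par k').
  by rewrite !block23_mul_block32.
rewrite !block32_canonical_pair !eqxx.
have bk := weight2_neq0 treeA k; have bk' := weight2_neq0 treeA k'.
have [pk|pk] := eqVneq (par k) (par k').
  rewrite -!mulr2n !mulrn_eq0/= => /(_ bk bk').
  by rewrite mulrnAl mulrnAr !pmulrn_lgt0.
by rewrite addr0 add0r => /(_ bk bk').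
Qed.

End TwoLayers.

Local Open Scope classical_set_scope.

(** * Linear combinations under continuity and integration *)

Section LinearCombinations.
Context {R : realType} {I : Type}.
Local Notation mu := (@lebesgue_measure R).
Variables (D : set R) (r : seq I) (c : I -> R) (f : I -> R -> R).

Lemma within_continuous_lincomb :
  (forall i, {within D, continuous (f i)}) ->
  {within D, continuous (fun s => \sum_(i <- r) c i * f i s)}.
Proof.
move=> cf; elim: r => [|i s IH].
  under eq_fun do rewrite big_nil.
  by move=> ?; exact: cvg_cst.
under eq_fun do rewrite big_cons.
move=> x; apply: cvgD; last exact: IH.
by apply: cvgM; [exact: cvg_cst|exact: cf].
Qed.

Lemma integrable_lincomb : measurable D ->
  (forall i, mu.-integrable D (EFin \o f i)) ->
  mu.-integrable D (EFin \o (fun s => \sum_(i <- r) c i * f i s)).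
Proof.
move=> mD fi.
apply: (@eq_integrable _ _ _ mu D mD
  (fun s => (\sum_(i <- r) (c i)%:E * (f i s)%:E)%E)) => [s _|].
  by rewrite /= -sumEFin.
apply: integrable_sum => // i _.
exact: (@integrableZl _ _ _ mu D mD (c i) (EFin \o f i)).
Qed.

End LinearCombinations.

Lemma Rintegral_lincomb (R : realType) (I : Type) (D : set R) (r : seq I)
    (c : I -> R) (f : I -> R -> R) : measurable D ->
  (forall i, (@lebesgue_measure R).-integrable D (EFin \o f i)) ->
  Rintegral (@lebesgue_measure R) D (fun s => \sum_(i <- r) c i * f i s) =
  \sum_(i <- r) c i * Rintegral (@lebesgue_measure R) D (f i).
Proof.
move=> mD fi; elim: r => [|i s IH].
  under eq_Rintegral do rewrite big_nil.
  by rewrite big_nil Rintegral_cst// mul0r.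
under eq_Rintegral do rewrite big_cons.
have ici : (@lebesgue_measure R).-integrable D (EFin \o (fun s => c i * f i s)).
  apply: (@eq_integrable _ _ _ (@lebesgue_measure R) D mD
    (fun s => ((c i)%:E * (f i s)%:E)%E)) => //.
  exact: (@integrableZl _ _ _ (@lebesgue_measure R) D mD (c i) (EFin \o f i)).
by rewrite RintegralD ?RintegralZl ?IH ?big_cons//; exact: integrable_lincomb.
Qed.

(** The equation makes [w] differentiable with derivative [lam * w], so multiplying by the
    integrating factor [expR (- lam * s)] gives a constant, which is 0 at time 0. *)
Lemma integral_equation_uniqueness (R : realType) (w : R -> R) (lam tf : R) :
  {within `[0, tf], continuous w} ->
  (forall t, 0 <= t <= tf ->
    w t = Rintegral (@lebesgue_measure R) `[0, t[ (fun s => lam * w s)) ->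
  forall t, 0 <= t <= tf -> w t = 0.
Proof.
move=> cw wE t /andP[]; rewrite le_eqVlt => /predU1P[<- tf0|t0 ttf].
  by rewrite wE ?lexx ?tf0// set_itvco0 Rintegral_set0.
have sub01 : `[0, t] `<=` `[0, tf].
  by apply: subset_itvl; rewrite bnd_simp.
have cf : {within `[0, t], continuous (fun s => lam * w s)}.
  move=> x; apply: cvgM; first exact: cvg_cst.
  exact: continuous_subspaceW sub01 cw x.
have fi : (@lebesgue_measure R).-integrable `[0, t]
    (EFin \o (fun s => lam * w s)).
  by apply: continuous_compact_integrable => //; exact: segment_compact.
(* The closed interval differs from the half-open one by a null set and suits the fundamental
   theorem of calculus. *)
pose W s := Rintegral (@lebesgue_measure R) `[0, s] (fun s => lam * w s).
have wW s : 0 <= s <= t -> w s = W s.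
  move=> /andP[s0 st]; rewrite wE ?s0 ?(le_trans st)// /W.
  apply: Rintegral_itv_bndo_bndc; apply: integrableS fi => //.
  by apply: subset_itvl; rewrite bnd_simp.
have cW : {within `[0, t], continuous W}.
  exact: parameterized_integral_continuous (ltW t0) fi.
have dW s : s \in `]0, t[%R -> is_derive s 1 W (lam * W s).
  move=> s0t; have /andP[s0 st] : 0 < s < t by move: s0t; rewrite in_itv.
  rewrite -wW ?(ltW s0) ?(ltW st)//.
  have cfs : {for s, continuous (fun s => lam * w s)}.
    by have /(continuous_within_itvP _ t0)[/(_ s s0t)] := cf.
  have [dWs Ws] := continuous_FTC1_closed st fi s0 cfs.
  by apply: DeriveDef; [exact: dWs|rewrite -derive1E; exact: Ws].
pose g s := W s * expR (- lam * s).
have dg y : y \in `]0, t[%R -> is_derive y 1 g 0.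
  move=> /dW dWy; rewrite /g; apply: is_derive_eq.
  by rewrite /GRing.scale/=; ring.
have cg : {within `[0, t], continuous g}.
  move=> y; apply: cvgM; first exact: cW.
  apply: continuous_subspaceT => {}y; apply: continuous_comp.
    by apply: cvgM => //; exact: cvg_cst.
  exact: continuous_expR.
have [c _] := MVT t0 dg cg.
rewrite mul0r /g {2}/W set_itv1 Rintegral_set1 mul0r subr0 => /eqP.
by rewrite mulf_eq0 (gt_eqF (expR_gt0 _)) orbF -wW ?lexx ?(ltW t0)// => /eqP.
Qed.

(** * Covectors vanishing on all states reachable from the origin *)

Section Silent.
Context {R : realType} {n m : nat}.
Variables (A : 'M[R]_n) (B : 'M[R]_(n, m)).

Definition dt_silent (z : 'rV[R]_n) : Prop :=
  forall tf u x, dt_trajectory A B tf u x -> x 0%N = 0 ->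
  forall t, (t <= tf)%N -> z *m x t = 0.

Definition ct_silent (z : 'rV[R]_n) : Prop :=
  forall tf u x, ct_trajectory A B tf u x -> x 0 = 0 ->
  forall t, 0 <= t <= tf -> z *m x t = 0.

Definition silent (T : time_domain) : 'rV[R]_n -> Prop :=
  match T with
  | ContinuousTime => ct_silent
  | DiscreteTime => dt_silent
  end.

(** Along a trajectory, [z *m x] obeys a scalar recursion of ratio [lam] without input or forcing,
    started at 0. *)
Lemma dt_silent_chain (lam : R) (z w : 'rV[R]_n) :
  dt_silent w -> z *m B = 0 -> z *m A = lam *: z + w -> dt_silent z.
Proof.
move=> sw zB zA tf u x trx x0; elim=> [_|t IH ttf]; first by rewrite x0 mulmx0.
rewrite trx// mulmxDr !mulmxA zB mul0mx addr0 zA mulmxDl -scalemxAl.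
by rewrite IH ?(ltnW ttf)// scaler0 add0r (sw _ _ _ trx x0)// ltnW.
Qed.

(** The scalar [z *m x] solves the homogeneous integral equation of rate [lam] and hence
    vanishes. *)
Lemma ct_silent_chain (lam : R) (z w : 'rV[R]_n) :
  ct_silent w -> z *m B = 0 -> z *m A = lam *: z + w -> ct_silent z.
Proof.
move=> sw zB zA tf u x trx x0 t ttf.
have [ui cx xE] := trx.
have zxE s : (z *m x s) 0 0 = \sum_i z 0 i * x s i 0 by rewrite mxE.
apply/matrixP => i j; rewrite !ord1 [RHS]mxE {i j}.
apply: (@integral_equation_uniqueness R (fun s => (z *m x s) 0 0) lam tf) ttf.
  by rewrite (funext zxE); exact: within_continuous_lincomb.
move=> {}t ttf; have /andP[t0 tf1] := ttf.
pose F i s := (A *m x s + B *m u s) i 0.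
have Fi i : (@lebesgue_measure R).-integrable `[0, t[ (EFin \o F i).
  have sub : `[0, t[ `<=` `[0, tf[ by apply: subset_itvl; rewrite bnd_simp.
  (* Indexing by a sum type makes the right-hand side a single linear combination of state and input
     coordinates. *)
  pose cf (k : 'I_n + 'I_m) := match k with inl k => A i k | inr k => B i k end.
  pose ff (k : 'I_n + 'I_m) s :=
    match k with inl k => x s k 0 | inr k => u s k 0 end.
  have FE : F i = fun s => \sum_k cf k * ff k s.
    by apply/funext => s; rewrite big_sumType /F !mxE.
  rewrite FE; apply: integrable_lincomb => // -[k|k]; last first.
    apply: (@integrableS _ _ _ (@lebesgue_measure R) `[0, tf[) => //.
    exact: ui.
  apply: (@integrableS _ _ _ (@lebesgue_measure R) `[0, tf]) => //.
    by apply: (subset_trans sub); apply: subset_itvl; rewrite bnd_simp.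
  by apply: continuous_compact_integrable; [exact: segment_compact|exact: cx].
rewrite zxE (eq_bigr (fun i => z 0 i * Rintegral (@lebesgue_measure R)
    `[0, t[ (F i))); last by move=> i _; rewrite (xE _ ttf) x0 mxE add0r.
rewrite -Rintegral_lincomb//; apply: eq_Rintegral => s.
rewrite inE/= in_itv/= => /andP[s0 st].
have -> : \sum_i z 0 i * F i s = (z *m (A *m x s + B *m u s)) 0 0.
  by rewrite mxE.
rewrite mulmxDr !mulmxA zB mul0mx addr0 zA mulmxDl -scalemxAl.
by rewrite (sw _ _ _ trx x0) ?addr0 ?mxE// s0 (le_trans (ltW st)).
Qed.

Lemma silent_chain (T : time_domain) (lam : R) (z w : 'rV[R]_n) :
  silent T w -> z *m B = 0 -> z *m A = lam *: z + w -> silent T z.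
Proof. by case: T; [exact: ct_silent_chain|exact: dt_silent_chain]. Qed.

Lemma silent0 (T : time_domain) : silent T 0.
Proof. by case: T => tf u x _ _ t _; rewrite mul0mx. Qed.

Lemma silentZ (T : time_domain) (c : R) z : silent T z -> silent T (c *: z).
Proof.
by case: T => sz tf u x trx x0 t ttf;
  rewrite -scalemxAl (sz _ _ _ trx x0)// scaler0.
Qed.

(** The state is the endpoint of a trajectory from the origin to the threshold 1. *)
Lemma herdable_silent (T : time_domain) : herdable T A B ->
  exists2 x : 'cV[R]_n, (forall i, 0 < x i 0)
    & forall z, silent T z -> z *m x = 0.
Proof.
case: T => /(_ 0 1 ltr01)[tf [u [x [tf0 x0 trx x1]]]].
  exists (x tf) => [i|z sz]; first exact: lt_le_trans ltr01 (x1 i).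
  by apply: sz trx x0 _ _; rewrite lexx ltW.
exists (x tf) => [i|z sz]; first exact: lt_le_trans ltr01 (x1 i).
exact: sz trx x0 _ _.
Qed.

End Silent.

Local Close Scope classical_set_scope.

Lemma row_functional_ext (R : comNzRingType) (n : nat) (z w : 'rV[R]_n) :
  (forall x : 'cV[R]_n, (z *m x) 0 0 = (w *m x) 0 0) -> z = w.
Proof.
move=> zw; apply/rowP => v; have := zw (delta_mx v 0).
by rewrite -!colE !mxE.
Qed.

(** * Necessity *)

Section Necessity.
Context {R : realType} {m1 m2 : nat} {A : 'M[R]_(1 + (m1 + m2))}.
Context {a : 'I_m1 -> R} {b : 'I_m2 -> R} {par : 'I_m2 -> 'I_m1}.
Hypothesis treeA : two_layer_tree A a b par.

Local Notation l := (leader m1 m2).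
Local Notation f1 := (@follower1 m1 m2).
Local Notation f2 := (@follower2 m1 m2).
Local Notation B := (canonical_vec R l).
Local Notation d := (star_weight b par).
Local Notation coord v := (delta_mx 0 v : 'rV[R]_(1 + (m1 + m2))).

Definition contrast1 i j := a j *: coord (f1 i) - a i *: coord (f1 j).

Definition contrast2 k k' :=
  (b k' * a (par k')) *: coord (f2 k) - (b k * a (par k)) *: coord (f2 k').

Lemma contrast1E i j (x : 'cV_(1 + (m1 + m2))) :
  (contrast1 i j *m x) 0 0 = a j * x (f1 i) 0 - a i * x (f1 j) 0.
Proof. by rewrite /contrast1 mulmxBl -!scalemxAl -!rowE !mxE. Qed.

Lemma contrast2E k k' (x : 'cV_(1 + (m1 + m2))) : (contrast2 k k' *m x) 0 0 =
  b k' * a (par k') * x (f2 k) 0 - b k * a (par k) * x (f2 k') 0.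
Proof. by rewrite /contrast2 mulmxBl -!scalemxAl -!rowE !mxE. Qed.

(** The coefficients of [contrast1] are chosen to make the two contributions of the leader cancel
    here. *)
Lemma contrast1_mulmx i j (x : 'cV_(1 + (m1 + m2))) :
  (contrast1 i j *m (A *m x)) 0 0 =
  a j * (\sum_(k | par k == i) b k * x (f2 k) 0)
  - a i * (\sum_(k | par k == j) b k * x (f2 k) 0).
Proof. by rewrite contrast1E !(mulmx_follower1 treeA); ring. Qed.

Lemma contrast1_input i j : contrast1 i j *m B = 0.
Proof.
apply/matrixP => ? ?; rewrite !ord1 contrast1E !mxE /=.
by rewrite !mulr0 subrr.
Qed.

Lemma contrast1_A_input i j : contrast1 i j *m A *m B = 0.
Proof.
apply/matrixP => ? ?; rewrite !ord1 -mulmxA contrast1_mulmx [RHS]mxE.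
by rewrite !big1 ?mulr0 ?subrr// => k _; rewrite mxE mulr0.
Qed.

(** Going down to the children and back multiplies coordinate [i] by [d i] and coordinate [j] by
    [d j]; equality of the two makes [contrast1] an eigenvector. *)
Lemma contrast1_A_A i j : d i = d j ->
  contrast1 i j *m A *m A = d i *: contrast1 i j.
Proof.
move=> dij; apply: row_functional_ext => x.
have sumE i' : \sum_(k | par k == i') b k * (A *m x) (f2 k) 0 =
    d i' * x (f1 i') 0.
  rewrite mulr_suml; apply: eq_bigr => k /eqP <-.
  by rewrite (mulmx_follower2 treeA) mulrA.
rewrite -(mulmxA _ A x) -(mulmxA _ A (A *m x)) contrast1_mulmx !sumE -dij
  -scalemxAl [RHS]mxE contrast1E.
by ring.
Qed.

(** The term in [0 *:] gives the shape required by [silent_chain]. *)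
Lemma contrast2_A k k' :
  contrast2 k k' *m A =
  0 *: contrast2 k k' + (b k * b k') *: contrast1 (par k) (par k').
Proof.
apply: row_functional_ext => x.
rewrite -mulmxA contrast2E !(mulmx_follower2 treeA) scale0r add0r.
by rewrite -scalemxAl [RHS]mxE contrast1E; ring.
Qed.

Lemma contrast2_input k k' : contrast2 k k' *m B = 0.
Proof.
apply/matrixP => ? ?; rewrite !ord1 contrast2E !mxE /=.
by rewrite !mulr0 subrr.
Qed.

(** As [d i] is nonnegative, it has a real root [s], and [A ^ 2 - d i] factors into [A - s] and
    [A + s]: two scalar chains suffice. *)
Lemma contrast1_silent T i j : d i = d j -> silent A B T (contrast1 i j).
Proof.
move=> dij; set p := contrast1 i j; set s := Num.sqrt (d i).
have ss : s * s = d i by rewrite -expr2 sqr_sqrtr// star_weight_ge0.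
(* [p *m A + s *: p] is a left eigenvector of A for the eigenvalue s. *)
have sq : silent A B T (p *m A + s *: p).
  apply: (silent_chain (lam := s) (silent0 A B T)).
    rewrite mulmxDl contrast1_A_input -scalemxAl contrast1_input.
    by rewrite scaler0 addr0.
  rewrite mulmxDl contrast1_A_A// -scalemxAl addr0.
  by rewrite [s *: (_ + _)]scalerDr scalerA ss addrC.
apply: (silent_chain (lam := - s) sq); first exact: contrast1_input.
by rewrite scaleNr addrC addrK.
Qed.

Lemma contrast2_silent T k k' : d (par k) = d (par k') ->
  silent A B T (contrast2 k k').
Proof.
move=> dkk'; apply: (silent_chain (lam := 0)) (contrast2_A k k').
  exact/silentZ/contrast1_silent.
exact: contrast2_input.
Qed.

Lemma herdable_aligned T : herdable T A B -> aligned a b par.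
Proof.
move=> /herdable_silent[x x_gt0 sx].
have a_pos i j : d i = d j -> 0 < a i * a j.
  move=> /(@contrast1_silent T)/sx/matrixP/(_ 0 0).
  rewrite contrast1E mxE => /eqP; rewrite subr_eq0 => /eqP axx.
  (* From [a j * x_i = a i * x_j] follows [a i * a j * x_j = a j ^ 2 * x_i], which is positive. *)
  rewrite -(pmulr_lgt0 _ (x_gt0 (f1 j))) mulrAC -axx mulrAC.
  by rewrite pmulr_lgt0 ?x_gt0// -expr2 exprn_even_gt0// (weight1_neq0 treeA).
split=> // k k' dkk'.
have /sx/matrixP/(_ 0 0) := @contrast2_silent T k k' dkk'.
rewrite contrast2E mxE => /eqP; rewrite subr_eq0 => /eqP bxx.
have akk := a_pos _ _ dkk'.
(* By the vanishing of [contrast2], this product equals [(b k' * a (par k')) ^ 2 * x_k]. *)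
have : 0 < b k * b k' * (a (par k) * a (par k')) * x (f2 k') 0.
  rewrite (_ : _ * _ = b k' * a (par k') * (b k * a (par k) * x (f2 k') 0)).
    rewrite -bxx mulrA pmulr_lgt0 ?x_gt0// -expr2 exprn_even_gt0//=.
    by rewrite mulf_neq0 ?(weight1_neq0 treeA) ?(weight2_neq0 treeA).
  by ring.
by rewrite pmulr_lgt0// pmulr_lgt0.
Qed.

End Necessity.

(** * Flat outputs *)

Section EvenOperator.
Context {R : realType}.
Variable D : {linear {poly R} -> {poly R}}.

(* p(D^2) th *)
Definition even_op (p th : {poly R}) : {poly R} :=
  \sum_(j < size p) p`_j *: iter j.*2 D th.

Lemma even_op_wide n (p th : {poly R}) : (size p <= n)%N ->
  even_op p th = \sum_(j < n) p`_j *: iter j.*2 D th.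
Proof.
move=> pn.
rewrite /even_op (big_ord_widen _ (fun j => p`_j *: iter j.*2 D th) pn).
rewrite big_mkcond; apply: eq_bigr => j _; case: ltnP => // pj.
by rewrite nth_default ?scale0r.
Qed.

(** Multiplication by ['X] shifts the coefficients by one place, which amounts to applying [D] twice
    more. *)
Lemma even_op_XsubC e (p th : {poly R}) :
  even_op (('X - e%:P) * p) th = D (D (even_op p th)) - e *: even_op p th.
Proof.
pose n := size p.
have sXp : (size (('X - e%:P) * p)%R <= n.+1)%N.
  by rewrite (leq_trans (size_polyMleq _ _))// size_XsubC.
rewrite (even_op_wide _ sXp) (eq_bigr (fun j : 'I_n.+1 =>
    ('X * p)%R`_j *: iter j.*2 D th - (e * p`_j) *: iter j.*2 D th));
  last first.
  by move=> j _; rewrite mulrBl coefB coefCM scalerBl.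
rewrite sumrB; congr (_ - _); last first.
  rewrite (@even_op_wide n.+1)// scaler_sumr; apply: eq_bigr => j _.
  by rewrite scalerA.
rewrite big_ord_recl coefXM scale0r add0r 2!linear_sum; apply: eq_bigr => j _.
by rewrite coefXM !linearZ.
Qed.

(** Even and odd jets enter separately, so the first layer can be prescribed independently of the
    leader and the second layer. *)
Lemma even_op_moments (ev : {scalar {poly R}}) (N : nat) (J : nat -> R)
    (p th : {poly R}) :
  (forall j, (j < N.*2)%N -> ev (iter j D th) = J j) -> (size p <= N)%N ->
  ev (even_op p th) = \sum_(j < N) p`_j * J j.*2 /\
  ev (D (even_op p th)) = \sum_(j < N) p`_j * J j.*2.+1.
Proof.
move=> evJ pN; rewrite (even_op_wide _ pN) !linear_sum; split; apply: eq_bigr.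
  by move=> j _; rewrite linearZ/= evJ// ltn_double.
by move=> j _; rewrite !linearZ -iterS evJ// ltn_Sdouble.
Qed.

End EvenOperator.

(** Pairing the coefficients of [p] with the power moments of a discrete measure integrates [p]
    against that measure. *)
Lemma sum_coef_powers (R : comNzRingType) (I : Type) (r : seq I) (N : nat)
    (p : {poly R}) (c x : I -> R) : (size p <= N)%N ->
  \sum_(j < N) p`_j * (\sum_(i <- r) c i * x i ^+ j) =
  \sum_(i <- r) c i * p.[x i].
Proof.
move=> pN; under eq_bigr do rewrite mulr_sumr.
rewrite exchange_big; apply: eq_bigr => i _ /=.
rewrite (horner_coef_wide _ pN) mulr_sumr; apply: eq_bigr => j _.
exact: mulrCA.
Qed.

(** * Interpolation polynomials over distinct nodes *)

Section LagrangeBasis.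
Context {R : idomainType}.
Variable E : seq R.
Hypothesis uE : uniq E.

Definition node_poly : {poly R} := \prod_(e <- E) ('X - e%:P).

(** Lagrange basis polynomial without normalisation. *)
Definition lagrange_poly (e : R) : {poly R} :=
  \prod_(e' <- rem e E) ('X - e'%:P).

Lemma node_poly_rem e : e \in E -> node_poly = ('X - e%:P) * lagrange_poly e.
Proof. exact: big_rem. Qed.

Lemma root_node_poly e : root node_poly e = (e \in E).
Proof. exact: root_prod_XsubC. Qed.

Lemma root_lagrange_poly e e' : root (lagrange_poly e) e' = (e' \in rem e E).
Proof. exact: root_prod_XsubC. Qed.

Lemma size_node_poly : size node_poly = (size E).+1.
Proof. exact: size_prod_XsubC. Qed.

Lemma size_lagrange_poly e : (size (lagrange_poly e) <= (size E).+1)%N.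
Proof.
rewrite size_prod_XsubC ltnS; exact: size_subseq (rem_subseq _ _).
Qed.

Lemma lagrange_poly_neq0 e : (lagrange_poly e).[e] != 0.
Proof. by rewrite -/(root _ e) root_lagrange_poly mem_rem_uniq// !inE eqxx. Qed.

Lemma sum_lagrange_poly (c : R -> R) e : e \in E ->
  \sum_(e' <- E) c e' * (lagrange_poly e).[e'] = c e * (lagrange_poly e).[e].
Proof.
move=> eE; rewrite (big_rem e)//= big_seq big1 ?addr0// => e' e'E.
have /rootP-> : root (lagrange_poly e) e' by rewrite root_lagrange_poly.
exact: mulr0.
Qed.

End LagrangeBasis.

Definition node_fun (S : Type) (m1 m2 : nat) (s : S) (y : 'I_m1 -> S)
    (z : 'I_m2 -> S) (v : 'I_(1 + (m1 + m2))) : S :=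
  match fintype.split v with
  | inl _ => s
  | inr w => match fintype.split w with inl i => y i | inr k => z k end
  end.

Section NodeFun.
Context {S : Type} {m1 m2 : nat} (s : S) (y : 'I_m1 -> S) (z : 'I_m2 -> S).

Lemma node_funL : node_fun s y z (leader m1 m2) = s.
Proof. by rewrite /node_fun (unsplitK (inl ord0)). Qed.

Lemma node_fun1 i : node_fun s y z (follower1 m2 i) = y i.
Proof. by rewrite /node_fun (unsplitK (inr _)) (unsplitK (inl i)). Qed.

Lemma node_fun2 k : node_fun s y z (follower2 m1 k) = z k.
Proof. by rewrite /node_fun (unsplitK (inr _)) (unsplitK (inr k)). Qed.

End NodeFun.

(** Common interface of the two time domains: a polynomial encodes a sequence by its coefficients,
    or a function of real time; [ev0] and [ev1] read it at the initial and the final time. *)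
Definition reaches_jets (R : realType) (N : nat)
    (D : {poly R} -> {poly R}) (ev0 ev1 : {poly R} -> R) : Prop :=
  forall J : nat -> R, exists th : {poly R},
    forall j, (j < N)%N -> ev0 (iter j D th) = 0 /\ ev1 (iter j D th) = J j.

(** * A flat trajectory from the origin to a positive state *)

Section FlatOutput.
Context {R : realType} {m1 m2 : nat}.
Context {a : 'I_m1 -> R} {b : 'I_m2 -> R} {par : 'I_m2 -> 'I_m1}.
Hypothesis ab_aligned : aligned a b par.

Local Notation l := (leader m1 m2).
Local Notation f1 := (@follower1 m1 m2).
Local Notation f2 := (@follower2 m1 m2).
Local Notation d := (star_weight b par).

Definition star_weights : seq R := undup [seq d i | i : 'I_m1].

Local Notation E := star_weights.

Lemma mem_star_weights i : d i \in E.
Proof. by rewrite mem_undup map_f ?mem_enum. Qed.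

(** Alignment lets any first-layer node of weight [e] represent the sign for all of them; the
    default 0 is never met at a weight [d i]. *)
Lemma ex_sign1 : exists s : R -> R, forall i, 0 < a i * s (d i).
Proof.
exists (fun e => if [pick i | d i == e] is Some i then a i else 0) => i.
case: pickP => [j /eqP dj|/(_ i)]; last by rewrite eqxx.
by apply: ab_aligned.1.
Qed.

Lemma ex_sign2 : exists s : R -> R,
  forall k, 0 < b k * a (par k) * s (d (par k)).
Proof.
exists (fun e => if [pick k | d (par k) == e] is Some k
  then b k * a (par k) else 0) => k.
case: pickP => [k' /eqP dk|/(_ k)]; last by rewrite eqxx.
by rewrite mulrACA mulr_gt0// ?ab_aligned.1// ab_aligned.2.
Qed.

Lemma flat_output (D : {linear {poly R} -> {poly R}})
    (ev0 ev1 : {scalar {poly R}}) :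
  reaches_jets m1.+1.*2 D ev0 ev1 ->
  exists xi : 'I_(1 + (m1 + m2)) -> {poly R},
  [/\ forall v, ev0 (xi v) = 0, forall v, 0 < ev1 (xi v),
      forall i, D (xi (f1 i)) =
        a i *: xi l + \sum_(k | par k == i) b k *: xi (f2 k)
    & forall k, D (xi (f2 k)) = b k *: xi (f1 (par k))].
Proof.
move=> jets; have uE : uniq E := undup_uniq _.
pose P := node_poly E; pose L := lagrange_poly E.
have [s1 s1_gt0] := ex_sign1; have [s2 s2_gt0] := ex_sign2.
(* The moment -1, which is not a root of P because the star weights are
   nonnegative, makes the leader positive. *)
have PN1 : P.[-1] != 0.
  rewrite -/(root _ _) root_node_poly mem_undup.
  apply/mapP => -[i _ dE]; have := star_weight_ge0 b par i.
  by rewrite -dE ler0N1.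
(* The final jet consists of moments of discrete measures: the even part has masses [c] on [E] and
   [cs] at -1, the odd part masses [g] on [E]. The mass [cs] sets the leader to 1, and [c]
   compensates its effect on the second layer; the followers then end at [a i * s1 (d i)] and
   [b k * a (par k) * s2 (d (par k))]. *)
pose cs := P.[-1]^-1.
pose c e := (s2 e - cs * (L e).[-1]) / (L e).[e].
pose g e := s1 e / (L e).[e].
pose J j := if odd j then \sum_(e <- E) g e * e ^+ j./2
  else \sum_(e <- E) c e * e ^+ j./2 + cs * (-1) ^+ j./2.
have [th thJ'] := jets J.
have thJ j : (j < (size E).+1.*2)%N ->
    ev0 (iter j D th) = 0 /\ ev1 (iter j D th) = J j.
  (* Removing duplicates leaves at most [m1] weights, so enough jets are prescribed. *)
  move=> jE; apply: thJ'; apply: leq_trans jE _; rewrite leq_double ltnS.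
  by rewrite (leq_trans (size_undup _))// size_map size_enum_ord.
have ev0_op (p : {poly R}) : (size p <= (size E).+1)%N ->
    ev0 (even_op D p th) = 0 /\ ev0 (D (even_op D p th)) = 0.
  move=> sp; have th0 j : (j < (size E).+1.*2)%N -> ev0 (iter j D th) = 0.
    by move=> /thJ[].
  have [-> ->] := even_op_moments (J := fun=> 0) th0 sp.
  by rewrite !big1// => j _; rewrite mulr0.
have ev1_op (p : {poly R}) : (size p <= (size E).+1)%N ->
    ev1 (even_op D p th) = \sum_(e <- E) c e * p.[e] + cs * p.[-1] /\
    ev1 (D (even_op D p th)) = \sum_(e <- E) g e * p.[e].
  move=> sp; have th1 j : (j < (size E).+1.*2)%N -> ev1 (iter j D th) = J j.
    by move=> /thJ[].
  have [-> ->] := even_op_moments th1 sp; split.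
    rewrite -(sum_coef_powers _ _ id sp) (horner_coef_wide _ sp) mulr_sumr.
    rewrite -big_split; apply: eq_bigr => j _.
    rewrite /J odd_double doubleK/= mulrDr; congr (_ + _).
    by rewrite mulrCA.
  rewrite -(sum_coef_powers _ _ id sp); apply: eq_bigr => j _.
  by rewrite /J /= odd_double/= uphalf_double.
have sP : (size P <= (size E).+1)%N by rewrite size_node_poly.
have sL e : (size (L e) <= (size E).+1)%N := size_lagrange_poly _ _.
exists (node_fun (even_op D P th) (fun i => a i *: D (even_op D (L (d i)) th))
  (fun k => (b k * a (par k)) *: even_op D (L (d (par k))) th)); split.
- move=> v; case: (nodeP v) => [|i|k].
  + by rewrite node_funL (ev0_op _ sP).1.
  + by rewrite node_fun1 linearZ/= (ev0_op _ (sL _)).2 mulr0.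
  + by rewrite node_fun2 linearZ/= (ev0_op _ (sL _)).1 mulr0.
- move=> v; case: (nodeP v) => [|i|k].
  + rewrite node_funL (ev1_op _ sP).1 big_seq big1 ?add0r => [|e eE].
      by rewrite mulVf// ltr01.
    by have /rootP-> : root P e; rewrite ?root_node_poly// mulr0.
  + rewrite node_fun1 linearZ/= (ev1_op _ (sL _)).2 sum_lagrange_poly//.
      by rewrite divfK ?lagrange_poly_neq0.
    exact: mem_star_weights.
  + rewrite node_fun2 linearZ/= (ev1_op _ (sL _)).1 sum_lagrange_poly//.
      by rewrite divfK ?lagrange_poly_neq0// subrK.
    exact: mem_star_weights.
- move=> i; rewrite node_fun1 node_funL linearZ/=.
  (* As [P] is ['X - d i] times [L (d i)], the leader contributes the second iterate of [D] minus a
     [d i] term, which the children of [i] restore. *)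
  rewrite /P (node_poly_rem (mem_star_weights i)) even_op_XsubC -/(L _).
  rewrite scalerBr.
  rewrite (eq_bigr (fun k => (b k ^+ 2) *: (a i *: even_op D (L (d i)) th))).
    by rewrite -scaler_suml !scalerA [a i * _]mulrC subrK.
  by move=> k /eqP <-; rewrite node_fun2 !scalerA mulrA.
- move=> k; rewrite node_fun1 node_fun2 linearZ/= scalerA.
  by [].
Qed.

End FlatOutput.

(** * Trajectories with prescribed jets *)

(** A sequence whose first [N] terms vanish and whose next [N] terms are [J] does it. *)
Lemma shift_reaches_jets (R : realType) (N : nat) :
  reaches_jets N (@drop_poly R 1) (coefp 0) (coefp N).
Proof.
move=> J; exists ('X^N * \poly_(j < N) J j) => j jN.
have iterE p t : (iter j (@drop_poly R 1) p)`_t = p`_(t + j).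
  elim: j {jN} t => [|j IH] t; first by rewrite addn0.
  by rewrite iterS coef_drop_poly IH addn1 addSnnS.
rewrite /= /coefp !iterE !coefXnM add0n jN ltnNge leq_addr/=; split=> //.
by rewrite addKn coef_poly jN.
Qed.

Lemma horner_derivn (R : comNzRingType) (p : {poly R}) (c : R) (n : nat) :
  p^`(n).[c] = (p \Po ('X + c%:P))`_n *+ n`!.
Proof.
have -> : p^`(n).[c] = (p \Po ('X + c%:P))^`(n).[0].
  suff -> : (p \Po ('X + c%:P))^`(n) = p^`(n) \Po ('X + c%:P).
    by rewrite horner_comp !hornerE.
  elim: n => [//|n IH]; rewrite derivnS IH deriv_comp derivD derivX derivC.
  by rewrite addr0 mulr1.
by rewrite horner_coef0 coef_derivn addn0 ffactnn.
Qed.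

(** Hermite interpolation: by Bezout, [U * 'X^N] vanishes to order [N] at 0 and agrees with 1 to
    order [N] at 1; it multiplies the Taylor polynomial [T] of the jet at 1. *)
Lemma deriv_reaches_jets (R : realType) (N : nat) :
  reaches_jets N (@deriv R) (horner_eval 0) (horner_eval 1).
Proof.
move=> J.
have /Bezout_eq1_coprimepP[[U V] /= UV] :
    coprimep ('X^N : {poly R}) (('X - 1%:P) ^+ N).
  apply/coprimep_expl/coprimep_expr.
  by rewrite coprimep_XsubC rootE hornerX oner_neq0.
pose Q : {poly R} := \poly_(j < N) (J j / j`!%:R).
pose T := Q \Po ('X - 1%:P).
exists (U * 'X^N * T) => j jN; rewrite /horner_eval -!/(derivn _ _).
rewrite !horner_derivn addr0 comp_polyXr; split.
  by rewrite -mulrA mulrCA coefXnM jN mul0rn.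
have -> : U * 'X^N = 1 - V * ('X - 1%:P) ^+ N by rewrite -UV addrK.
rewrite mulrBl mul1r comp_polyB mulrAC [V * T * _]mulrC comp_polyM rmorphXn /=.
have -> : ('X - 1%:P) \Po ('X + 1%:P) = 'X :> {poly R}.
  by rewrite comp_polyB comp_polyX comp_polyC addrK.
rewrite coefB coefXnM jN subr0 /T -comp_polyA.
rewrite comp_polyB comp_polyX comp_polyC addrK comp_polyXr coef_poly jN.
by rewrite -[LHS]mulr_natr divfK ?pnatr_eq0 -?lt0n ?fact_gt0.
Qed.

Lemma large_multiple (R : realType) (n : nat) (y w : 'I_n -> R) (h : R) :
  (forall v, 0 < w v) -> exists c : R, forall v, h <= y v + c * w v.
Proof.
(* Each summand is what its own node needs, and the other summands are nonnegative. *)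
move=> w_gt0; exists (\sum_v `|h - y v| / w v) => v.
rewrite -lerBlDl (le_trans (ler_norm _))// -ler_pdivrMr//.
rewrite (bigD1 v)//= lerDl; apply: sumr_ge0 => v' _.
by rewrite divr_ge0// ltW.
Qed.

(** * Matching inputs and sufficiency in discrete time *)

Section Sufficiency.
Context {R : realType} {m1 m2 : nat} {A : 'M[R]_(1 + (m1 + m2))}.
Context {a : 'I_m1 -> R} {b : 'I_m2 -> R} {par : 'I_m2 -> 'I_m1}.
Hypothesis treeA : two_layer_tree A a b par.
Hypothesis ab_aligned : aligned a b par.

Local Notation l := (leader m1 m2).
Local Notation f1 := (@follower1 m1 m2).
Local Notation f2 := (@follower2 m1 m2).
Local Notation B := (canonical_vec R l).
Local Notation d := (star_weight b par).

(** Here [y'] is the next state or the derivative; the input acts on the leader alone and absorbs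
    any mismatch in its row. *)
Lemma matching_input (y y' : 'cV[R]_(1 + (m1 + m2))) :
  (forall i, y' (f1 i) 0 =
     a i * y l 0 + \sum_(k | par k == i) b k * y (f2 k) 0) ->
  (forall k, y' (f2 k) 0 = b k * y (f1 (par k)) 0) ->
  y' = A *m y + B *m (const_mx (y' l 0 - (A *m y) l 0) : 'cV_1).
Proof.
move=> y1 y2; apply/colP => v; set c := _ - _; rewrite mxE.
have -> : (B *m (const_mx c : 'cV_1)) v 0 = c *+ (v == l).
  by rewrite mxE big_ord1 !mxE eqxx andbT mulr_natl.
case: (nodeP v) => [|i|k].
- by rewrite eqxx mulr1n subrKC.
- by rewrite eq_sym leader_neq1 addr0 (mulmx_follower1 treeA).
- by rewrite eq_sym leader_neq2 addr0 (mulmx_follower2 treeA).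
Qed.

Lemma aligned_dt_herdable : dt_herdable A B.
Proof.
move=> x0 h _.
have [xi [xi0 xi_gt0 xi1 xi2]] := flat_output ab_aligned
  (@shift_reaches_jets R m1.+1.*2).
set tf := m1.+1.*2 in xi_gt0.
(* Evolution from [x0] under zero input, to which a large multiple of the flat trajectory is
   added. *)
pose x00 t := iter t (mulmx A) x0.
have [c ch] := large_multiple (fun v => x00 tf v 0) h xi_gt0.
pose y t : 'cV[R]_(1 + (m1 + m2)) := \col_v (xi v)`_t.
exists tf, (fun t => const_mx (c * (y t.+1 l 0 - (A *m y t) l 0))),
  (fun t => x00 t + c *: y t); split=> //.
- have -> : y 0%N = 0 by apply/colP => v; rewrite !mxE; exact: xi0.
  by rewrite scaler0 addr0.
- move=> t _; rewrite /x00 iterS mulmxDr -addrA; congr (_ + _).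
  have -> : const_mx (c * (y t.+1 l 0 - (A *m y t) l 0)) =
      c *: const_mx (y t.+1 l 0 - (A *m y t) l 0) :> 'cV_1.
    by apply/matrixP => i j; rewrite !mxE.
  rewrite -!scalemxAr -scalerDr; congr (_ *: _); apply: matching_input => [i|k].
    have := congr1 (coefp t) (xi1 i).
    rewrite /= coef_drop_poly addn1 coefD coefZ coef_sum !mxE => ->.
    by congr (_ + _); apply: eq_bigr => k _; rewrite coefZ mxE.
  have := congr1 (coefp t) (xi2 k).
  by rewrite /= coef_drop_poly addn1 coefZ !mxE.
- by move=> v; rewrite mxE [X in _ + X]mxE [y tf v 0]mxE; exact: ch.
Qed.

End Sufficiency.

Local Open Scope classical_set_scope.

(** * Calculus for continuous-time trajectories *)

Lemma is_derive_continuous (R : realType) (f : R -> R) (df t : R) :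
  is_derive t 1 f df -> {for t, continuous f}.
Proof.
by case=> dft _; exact/differentiable_continuous/derivable1_diffP.
Qed.

Lemma Rintegral_derivative (R : realType) (f df : R -> R) (t : R) : 0 <= t ->
  (forall s : R, is_derive s 1 f (df s)) -> {within `[0, t], continuous df} ->
  f t = f 0 + Rintegral (@lebesgue_measure R) `[0, t[ df.
Proof.
rewrite le_eqVlt => /predU1P[<- _ _|t0 fdf cdf].
  by rewrite set_itvco0 Rintegral_set0 addr0.
have cf s : {for s, continuous f} := is_derive_continuous (fdf s).
rewrite Rintegral_itv_bndo_bndc; last first.
  apply: (@integrableS _ _ _ (@lebesgue_measure R) `[0, t]) => //.
    by apply: subset_itvl; rewrite bnd_simp.
  by apply: continuous_compact_integrable => //; exact: segment_compact.
rewrite /Rintegral (continuous_FTC2 (F := f) t0 cdf) /= ?subrKC//.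
  split=> [s _||]; first by case: (fdf s).
    exact: cvg_at_right_filter (cf 0).
  exact: cvg_at_left_filter (cf t).
by move=> s _; rewrite derive1E; case: (fdf s).
Qed.

(** The right-hand side is continuous, so the fundamental theorem of calculus yields the integral
    equation. *)
Lemma smooth_ct_trajectory (R : realType) (n m : nat) (A : 'M[R]_n)
    (B : 'M[R]_(n, m)) (tf : R) (u : R -> 'cV[R]_m) (x : R -> 'cV[R]_n) :
  (forall k, {within `[0, tf], continuous (fun s => u s k 0)}) ->
  (forall (t : R) i,
    is_derive t 1 (fun s => x s i 0) ((A *m x t + B *m u t) i 0)) ->
  ct_trajectory A B tf u x.
Proof.
move=> cu dx.
have cx i t : {for t, continuous (fun s => x s i 0)}.
  exact: is_derive_continuous (dx t i).
split=> [k|i|t /andP[t0 ttf] i].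
- apply: (@integrableS _ _ _ (@lebesgue_measure R) `[0, tf]) => //.
    by apply: subset_itvl; rewrite bnd_simp.
  by apply: continuous_compact_integrable; [exact: segment_compact|exact: cu].
- by apply: continuous_subspaceT => t; exact: cx.
apply: (Rintegral_derivative (f := fun s => x s i 0)) t0 (dx^~ i) _.
pose cf (k : 'I_n + 'I_m) := match k with inl k => A i k | inr k => B i k end.
pose ff (k : 'I_n + 'I_m) s :=
  match k with inl k => x s k 0 | inr k => u s k 0 end.
have -> : (fun s => (A *m x s + B *m u s) i 0) = fun s => \sum_k cf k * ff k s.
  by apply/funext => s; rewrite big_sumType !mxE.
apply: within_continuous_lincomb => -[k|k].
  by apply: continuous_subspaceT => s; exact: cx.
by apply: continuous_subspaceW (cu k); apply: subset_itvl; rewrite bnd_simp.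
Qed.

(* [Q] is the primitive of a first-layer state when the leader is frozen. *)
Lemma frozen_leader_response (R : realType) (e y0 kappa : R) : 0 <= e ->
  exists Q Q' : R -> R, [/\ Q 0 = 0, Q' 0 = y0,
    forall t : R, is_derive t 1 Q (Q' t)
  & forall t : R, is_derive t 1 Q' (kappa + e * Q t)].
Proof.
(* For [e = 0] the solution is a quadratic polynomial. *)
rewrite le_eqVlt => /predU1P[<-|e0].
  exists (fun t => y0 * t + kappa / 2 * t ^+ 2), (fun t => y0 + kappa * t).
  split=> [||t|t]; rewrite ?expr0n/= ?mulr0 ?addr0//.
    by apply: is_derive_eq; rewrite /GRing.scale/=; field.
  by apply: is_derive_eq; rewrite /GRing.scale/=; ring.
pose s := Num.sqrt e; have s_gt0 : 0 < s by rewrite sqrtr_gt0.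
have es : e = s ^+ 2 by rewrite sqr_sqrtr// ltW.
have s_neq0 : s != 0 by rewrite gt_eqF.
(* Shifted by [kappa / e], [Q] solves the homogeneous equation of rates [s] and [- s]; [al] and [be]
   fit the values of [Q] and [Q'] at 0. *)
pose al := (kappa / e + y0 / s) / 2; pose be := (kappa / e - y0 / s) / 2.
exists (fun t => al * expR (s * t) + be * expR (- s * t) - kappa / e),
  (fun t => s * al * expR (s * t) - s * be * expR (- s * t)).
split=> [||t|t].
- by rewrite !mulr0 expR0 /al /be es; field.
- by rewrite !mulr0 expR0 /al /be es; field.
- by apply: is_derive_eq; rewrite /GRing.scale/=; ring.
- by apply: is_derive_eq; rewrite /GRing.scale/= es; field.
Qed.

(** * Sufficiency in continuous time *)

Section ContinuousSufficiency.
Context {R : realType} {m1 m2 : nat} {A : 'M[R]_(1 + (m1 + m2))}.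
Context {a : 'I_m1 -> R} {b : 'I_m2 -> R} {par : 'I_m2 -> 'I_m1}.
Hypothesis treeA : two_layer_tree A a b par.
Hypothesis ab_aligned : aligned a b par.

Local Notation l := (leader m1 m2).
Local Notation f1 := (@follower1 m1 m2).
Local Notation f2 := (@follower2 m1 m2).
Local Notation B := (canonical_vec R l).
Local Notation d := (star_weight b par).

Lemma aligned_ct_herdable : ct_herdable A B.
Proof.
move=> x0 h _.
have [xi [xi0 xi_gt0 xi1 xi2]] := flat_output ab_aligned
  (@deriv_reaches_jets R m1.+1.*2).
(* Initial derivative of node [i]. With the leader held at its initial value by the input, each star
   evolves alone, which gives the explicit trajectory [fr] from [x0]. *)
pose kappa i := a i * x0 l 0 + \sum_(k | par k == i) b k * x0 (f2 k) 0.
have /choice[Q /choice[Q' QP]] := fun i : 'I_m1 =>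
  frozen_leader_response (x0 (f1 i) 0) (kappa i) (star_weight_ge0 b par i).
pose fr (t : R) : 'I_(1 + (m1 + m2)) -> R := node_fun (x0 l 0) (fun i => Q' i t)
  (fun k => x0 (f2 k) 0 + b k * Q (par k) t).
have [c ch] := large_multiple (fr 1) h xi_gt0.
pose x t : 'cV[R]_(1 + (m1 + m2)) := \col_v (fr t v + c * (xi v).[t]).
pose x' t : 'cV[R]_(1 + (m1 + m2)) := \col_v (node_fun 0
  (fun i => kappa i + d i * Q i t) (fun k => b k * Q' (par k) t) v
  + c * (xi v)^`().[t]).
have dx (t : R) v : is_derive t 1 (fun s => x s v 0) (x' t v 0).
  rewrite (_ : (fun s => x s v 0) = fun s => fr s v + c * (xi v).[s]);
    last first.
    by apply/funext => s; rewrite mxE.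
  have dxi : is_derive t 1 (fun s => c * (xi v).[s]) (c * (xi v)^`().[t]).
    exact: (is_deriveZ c (is_derive_poly (xi v) t)).
  rewrite mxE; apply: is_deriveD dxi.
  rewrite /fr; case: (nodeP v) => [|i|k].
  - rewrite node_funL (_ : (fun=> _) = cst (x0 l 0)).
      exact: is_derive_cst.
    by apply/funext => s; rewrite node_funL.
  - rewrite node_fun1 (_ : (fun=> _) = Q' i); first by case: (QP i).
    by apply/funext => s; rewrite node_fun1.
  - rewrite node_fun2 (_ : (fun=> _) =
        fun s => x0 (f2 k) 0 + b k * Q (par k) s).
      case: (QP (par k)) => _ _ dQ _; apply: is_derive_eq.
      by rewrite add0r mul1r.
    by apply/funext => s; rewrite node_fun2.
have x'E t : x' t =
    A *m x t + B *m (const_mx (x' t l 0 - (A *m x t) l 0) : 'cV_1).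
  apply: (matching_input treeA) => [i|k].
    rewrite !mxE /fr node_fun1 node_funL xi1 hornerD hornerZ horner_sum /kappa.
    have -> : \sum_(k | par k == i) (b k *: xi (f2 k)).[t] =
        \sum_(k | par k == i) b k * (xi (f2 k)).[t].
      by apply: eq_bigr => k _; rewrite hornerZ.
    rewrite [in RHS](eq_bigr (fun k => b k * x0 (f2 k) 0 +
        (b k ^+ 2 * Q i t + c * (b k * (xi (f2 k)).[t])))) => [|k /eqP pk].
      rewrite 2!big_split /= -mulr_suml -mulr_sumr -/(d i); ring.
    by rewrite mxE /fr node_fun2 pk; ring.
  rewrite !mxE /fr !node_fun1 node_fun2 xi2 hornerZ; ring.
exists 1, (fun t => const_mx (x' t l 0 - (A *m x t) l 0)), x; split=> //.
- apply/colP => v; rewrite mxE /fr.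
  have -> : (xi v).[0] = 0 by exact: xi0.
  rewrite mulr0 addr0; case: (nodeP v) => [|i|k].
  + by rewrite node_funL.
  + by rewrite node_fun1; case: (QP i).
  + by rewrite node_fun2; case: (QP (par k)) => -> *; rewrite mulr0 addr0.
- apply: smooth_ct_trajectory => [k|t i]; last by rewrite -x'E.
  have -> : (fun s : R => (const_mx (x' s l 0 - (A *m x s) l 0) : 'cV_1) k 0) =
      (fun s => c * (xi l)^`().[s] - \sum_v A l v * x s v 0).
    by apply/funext => s; rewrite !mxE node_funL add0r.
  move=> s; apply: cvgB.
    apply: cvgM; first exact: cvg_cst.
    exact/continuous_subspaceT/continuous_horner.
  apply: within_continuous_lincomb => v; apply: continuous_subspaceT => {}s.
  exact: is_derive_continuous (dx s v).
- by move=> v; rewrite mxE; exact: ch.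
Qed.

End ContinuousSufficiency.

Local Close Scope classical_set_scope.

Theorem proposition11 (T : time_domain) (R : realType) (m1 m2 : nat)
    (A : 'M[R]_(1 + (m1 + m2)))
    (A_sym : A = A^T)
    (A_tree : is_tree (graph_of A))
    (layer1 : forall i : 'I_m1,
      at_distance (graph_of A) (leader m1 m2) (follower1 m2 i) 1)
    (layer2 : forall k : 'I_m2,
      at_distance (graph_of A) (leader m1 m2) (follower2 m1 k) 2) :
  herdable T A (canonical_vec R (leader m1 m2)) <->
  (forall i j : 'I_m1,
     (block23 A *m block32 A) i i = (block23 A *m block32 A) j j ->
     0 < block21 A i 0 * block21 A j 0 /\
     (block32 A *m (canonical_vec R i + canonical_vec R j) = 0 \/
      unisigned (block32 A *m (canonical_vec R i + canonical_vec R j)))).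
Proof.
have [a [b [par treeA]]] := two_layer_treeP A_sym A_tree layer1 layer2.
apply: iff_trans (iff_sym (aligned_blocks treeA)); split.
  by move/(herdable_aligned treeA).
by case: T; [exact: aligned_ct_herdable|exact: aligned_dt_herdable].
Qed.
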